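(* Let $k,m$ be positive integers with $k<m$ and $m$ odd, and let $k'$ be the unique solution modulo $m$ of $2x\equiv k \pmod m$. Let $G$ be a $2$-connected graph in which every cycle has length congruent to $k$ modulo $m$. Let $H$ be obtained from $G$ by attaching a new ear $E$ (a path whose two endpoints $u\ne v$ lie in $G$ and whose internal vertices are new), and suppose every cycle of $H$ also has length congruent to $k$ modulo $m$. Then (1) every path in $H$ connecting $u$ and $v$ has length congruent to $k'$ modulo $m$; and (2) for every ear decomposition $G=P_0\cup P_1\cup\cdots\cup P_t$ of $G$ (with $P_0$ a cycle and $P_1,\dots,P_t$ the ears in order of attachment), $u$ and $v$ lie on the same ear, i.e. $u,v\in V(P_i)$ for some $i\in\{0,\dots,t\}$.
   Context: Graphs are finite and simple. A graph is $2$-connected if it has at least $3$ vertices and no vertex whose removal disconnects it. The length of a path or cycle is its number of edges. An ear decomposition of a $2$-connected graph writes it as an initial cycle $P_0$ followed by paths $P_1,\dots,P_t$ where each $P_i$ has its two distinct endpoints in $P_0\cup\cdots\cup P_{i-1}$ and its internal vertices outside it. *)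

(* Defs.v *)
From mathcomp Require Import all_boot.
Set Implicit Arguments.
Unset Strict Implicit.
Unset Printing Implicit Defensive.

(* Graphs whose vertex set is a finite set of elements of an ambient finite
   type, so that a graph, its subgraphs and its one-ear extensions all have the
   same type. *)
Record graph (T : finType) := Graph { verts : {set T}; adj : rel T }.

Section Graphs.
Variable T : finType.
Implicit Types (G H : graph T) (u v x y : T) (p q c s : seq T).

Definition simple_graph G : Prop :=
  [/\ symmetric (adj G), irreflexive (adj G)
    & forall x y, adj G x y -> (x \in verts G) && (y \in verts G)].

Definition eq_graph G H : Prop := verts G = verts H /\ adj G =2 adj H.

Definition graph_union G H : graph T :=
  Graph (verts G :|: verts H) [rel x y | adj G x y || adj H x y].

Definition del_vertex G z : graph T :=
  Graph (verts G :\ z) [rel x y | [&& adj G x y, x != z & y != z]].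

Definition connected_graph G : Prop :=
  {in verts G &, forall x y, connect (adj G) x y}.

Definition two_connected G : Prop :=
  [/\ 2 < #|verts G|, connected_graph G
    & {in verts G, forall z, connected_graph (del_vertex G z)}].

(* The path with vertex sequence u :: p, which has size p edges. *)
Definition is_path G u p v : bool :=
  [&& u \in verts G, path (adj G) u p, uniq (u :: p) & last u p == v].

(* A cycle is given by its vertices in cyclic order; it has size c edges. *)
Definition is_cycle G c : bool := (2 < size c) && ucycleb (adj G) c.

Definition cycles_congruent G (k m : nat) : Prop :=
  forall c, is_cycle G c -> size c = k %[mod m].

(* The graph traced by a walk: its edges join consecutive entries of s. *)
Definition walk_graph s : graph T :=
  Graph [set x in s] [rel x y | infix [:: x; y] s || infix [:: y; x] s].

(* The path with vertex sequence u, p, v (p lists the internal vertices) has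
   distinct ends in G and its internal vertices outside G. *)
Definition is_ear G u p v : bool :=
  [&& u \in verts G, v \in verts G, uniq (u :: rcons p v)
    & all (fun x => x \notin verts G) p].

(* An ear with an internal vertex shares no edge with G; only a one-edge ear
   could repeat an edge of G, and it must not when the ear is new. *)
Definition is_new_ear G u p v : bool :=
  is_ear G u p v && ((p == [::]) ==> ~~ adj G u v).

Definition attach_ear G u p v : graph T :=
  graph_union G (walk_graph (u :: rcons p v)).

(* ear_chain G Ps: G is the union of Ps = [:: P_0; ...; P_t], P_0 being the
   vertices of a cycle in cyclic order and P_i (0 < i) the vertices, ends
   included, of an ear attached to the union of the previous ones. *)
Inductive ear_chain : graph T -> seq (seq T) -> Prop :=
| EarChainCycle x c :
    1 < size c -> uniq (x :: c) ->
    ear_chain (walk_graph (x :: rcons c x)) [:: x :: c]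
| EarChainAttach G Ps u p v :
    ear_chain G Ps -> is_ear G u p v ->
    ear_chain (attach_ear G u p v) (rcons Ps (u :: rcons p v)).

(* Up to eq_graph because adjacency is a function. *)
Definition ear_decomposition G (Ps : seq (seq T)) : Prop :=
  exists2 G', ear_chain G' Ps & eq_graph G' G.

End Graphs.

(* Main.v *)
(* Every u-v path P of G closes a cycle with E, so |P| = k - |E| mod m.  Two such
   paths forming a cycle of G give 2 |E| = k, hence |E| = k' = |P|, as m is odd.

   For the second part, take the last ear, with ends a, b, and suppose all x-y
   paths have length k', where x is inside the ear, at distances s and r from a
   and b, and y is elsewhere.  The rest of the graph contains a path from a
   through b to y; appending it, or only its part from b to y, to the two pieces
   of the ear gives s + k' = r, since its part from a to b has length k'.
   Symmetrically r + k' = s, so k = 2 k' = 0 mod m, contradicting 0 < k < m.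
   If both x and y lie in the rest of the graph, induct. *)
Require Import Defs.
From mathcomp Require Import all_boot zify.
Set Implicit Arguments.
Unset Strict Implicit.
Unset Printing Implicit Defensive.

(** * Duplicate-free sequences and reversed paths *)

Lemma count_le_uniq (T : eqType) (s s' : seq T) :
  uniq s' -> (forall x, count_mem x s <= count_mem x s') -> uniq s.
Proof.
move=> us' le_s; apply/count_mem_uniq => x.
have := le_s x; rewrite (count_uniq_mem x us') -[x \in s]has_pred1 has_count.
by case: (x \in s'); lia.
Qed.

Lemma path_rev_sym (T : Type) (e : rel T) x y p :
  symmetric e -> path e x (rcons p y) -> path e y (rcons (rev p) x).
Proof.
move=> sym_e pxy; have := rev_path e x (rcons p y).
rewrite last_rcons belast_rcons rev_cons => ->.
by rewrite (eq_path (e' := e)) // => a b; rewrite sym_e.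
Qed.

(** * Paths through a prescribed vertex *)

Section PathThrough.
Variables (T : finType) (e : rel T).
Hypothesis sym_e : symmetric e.

Let through a b y := exists p q,
  [/\ path e a (p ++ b :: q), last b q = y & uniq (a :: p ++ b :: q)].

(** The induction step for [path_through]: the end of a path from [a] through [b] moves along one
    edge. The path is cut at [z] if [z] comes at or after [b], extended if [z] is new, and rerouted
    if [z] comes before [b]. *)
Lemma through_step a b y z :
  (z != b -> connect [rel x1 x2 | [&& e x1 x2, x1 != z & x2 != z]] a b) ->
  e y z -> z != a -> through a b y -> through a b z.
Proof.
move=> ab_z yz za [p [q [pe lq upq]]].
have [zq|zNq] := boolP (z \in b :: q).
  case/splitPl: zq pe lq upq => q1 q2 lq1 pe _ upq.
  exists p, q1; split=> //.
    by move: pe; rewrite -cat_cons catA cat_path => /andP[].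
  by move: upq; rewrite -cat_cons -(cat_cons b) catA cat_uniq => /andP[].
have [zp|zNp] := boolP (z \in p); last first.
  exists p, (rcons q z); split; first 1 last.
  - by rewrite last_rcons.
  - rewrite -rcons_cons -rcons_cat -rcons_cons rcons_uniq upq andbT.
    by rewrite inE mem_cat (negPf za) (negPf zNp).
  by rewrite -rcons_cons -rcons_cat rcons_path pe last_cat /= lq.
(* The path a..z..b..y together with the edge yz closes a cycle through z and
   b; a path from a to that cycle avoiding z can be continued around it,
   through b, to z. *)
case/splitPr: zp pe lq upq => p1 p2 pe lq upq.
have {}pe : path e z (p2 ++ b :: q).
  by move: pe; rewrite -catA cat_path /= => /and3P[].
have uC : uniq (z :: p2 ++ b :: q).
  by move: upq; rewrite -catA -cat_cons cat_uniq => /and3P[].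
have aC : a \notin p2 ++ b :: q.
  apply: contraL upq => aC; rewrite /= negb_and negbK; apply/orP; left.
  by rewrite -catA mem_cat /= in_cons aC !orbT.
have zb : z != b by apply: contraNneq zNq => ->; rewrite mem_head.
have [r pr br] := connectP (ab_z zb).
case/shortenP: pr br => r' pr ur _ br.
have hasB : has (mem (p2 ++ b :: q)) r'.
  apply/hasP; exists b; last by rewrite /= mem_cat mem_head orbT.
  move: (mem_last a r'); rewrite -br in_cons => /orP[/eqP ba|//].
  by move: aC; rewrite -ba mem_cat mem_head orbT.
case: (split_find hasB) pr ur br => w i j wB iNB pr ur.
have {}pr : path [rel x1 x2 | [&& e x1 x2, x1 != z & x2 != z]] a (rcons i w).
  by move: pr; rewrite cat_path => /andP[].
have pew : path e a (rcons i w).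
  by apply: sub_path pr => x1 x2 /and3P[].
have zNi : z \notin rcons i w.
  apply/negP => zi; case/splitPr: zi pr => i1 i2.
  by rewrite cat_path /= eqxx !andbF.
have ui : uniq (a :: rcons i w).
  by move: ur; rewrite -cat_cons cat_uniq => /and3P[].
have uall : uniq (a :: i ++ (z :: p2 ++ b :: q)).
  have zi : z \notin i by apply: contra zNi; rewrite mem_rcons inE orbC => ->.
  move: ui; rewrite /= mem_rcons rcons_uniq inE negb_or => /and3P[/andP[_ ai] _ ui].
  rewrite mem_cat inE !negb_or ai aC eq_sym za cat_uniq ui uC andbT /=.
  by rewrite has_sym /= negb_or zi andbT; apply: iNB.
have qz : path e b (rcons q z).
  by move: pe; rewrite cat_path rcons_path lq yz => /= /and3P[_ _ ->].
(* Every rerouted path rearranges some segments of this duplicate-free sequence, so comparing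
   multiplicities reduces its uniqueness to [lia]. *)
have lt_uniq s : (forall x, count_mem x s <=
    count_mem x (a :: i ++ (z :: p2 ++ b :: q))) -> uniq s.
  exact: count_le_uniq.
(* The path from [a] first meets the cycle at [w]. From there it takes a direction that meets [b]
   before [z]: forwards if [w] is on [p2] or is [b], backwards if [w] is on [q]. *)
move: wB; rewrite /= mem_cat inE => /or3P[wp2|/eqP wb|wq].
- case/splitPr: wp2 pe lt_uniq {uC aC hasB uall iNB} => p3 p4 pe lt_uniq.
  exists (i ++ w :: p4), (rcons q z); split; last 1 first.
  + by apply: lt_uniq => x; rewrite /= -?cats1; do 6!rewrite ?(count_cat, count_rev) /=; clear; lia.
  + rewrite -catA -(cat_rcons w) cat_path pew last_rcons cat_path /= qz.
    by move: pe; rewrite -catA cat_path /= cat_path /= => /and5P[_ _ -> ->].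
  + by rewrite last_rcons.
- rewrite {}wb in pew.
  exists i, (rcons q z); split; last 1 first.
  + by apply: lt_uniq => x; rewrite /= -?cats1; do 6!rewrite ?(count_cat, count_rev) /=; clear; lia.
  + by rewrite -cat_rcons cat_path pew last_rcons.
  + by rewrite last_rcons.
- case/splitPr: wq pe lt_uniq {uC aC hasB uall iNB lq qz} => q1 q2 pe lt_uniq.
  exists (rcons i w ++ rev q1), (rcons (rev p2) z); split; last 1 first.
  + by apply: lt_uniq => x; rewrite /= -?cats1; do 6!rewrite ?(count_cat, count_rev) /=; clear; lia.
  + have /and3P[zpb bw _] :
        [&& path e z (rcons p2 b), path e b (rcons q1 w) & path e w q2].
      move: pe; rewrite -(cat_rcons b) cat_path last_rcons.
      by rewrite -(cat_rcons w) cat_path last_rcons.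
    rewrite -catA cat_path pew last_rcons -(cat_rcons b) cat_path last_rcons.
    by rewrite !path_rev_sym.
  + by rewrite last_rcons.
Qed.
End PathThrough.

(** * Congruences *)

(** With a multiple of [m] on each side no subtraction occurs, so a combination of congruences
    becomes a linear problem for [lia] once the multiples are added up. *)
Lemma eqmodP m x y :
  x = y %[mod m] <-> exists c d, x + c * m = y + d * m.
Proof.
split=> [xy|[c [d]]]; last first.
  by rewrite ![_ + _ * m]addnC => xy; rewrite -(modnMDl c) xy modnMDl.
exists (y %/ m), (x %/ m).
by have := divn_eq x m; have := divn_eq y m; rewrite xy; lia.
Qed.

(** For odd [m], the number [m./2.+1] is the inverse of 2 modulo [m]. *)
Lemma modn_double_inj m x y : odd m -> 2 * x = 2 * y %[mod m] -> x = y %[mod m].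
Proof.
move=> m_odd xy.
have half z : z = m./2.+1 * (2 * z) %[mod m].
  have -> : m./2.+1 * (2 * z) = z * m + z by have := odd_double_half m; nia.
  by rewrite modnMDl.
by rewrite half [RHS]half -modnMmr xy modnMmr.
Qed.

(** * Paths and neighbours in 2-connected graphs *)

Section Graphs.
Variable T : finType.
Implicit Types (G H : graph T) (a b x y z w : T) (p q s : seq T).

(** The invariant carried along an ear chain; the bound on the number of vertices is kept apart. *)
Definition biconnected G : Prop :=
  [/\ symmetric (adj G), forall x y, adj G x y -> y \in verts G, connected_graph G
    & {in verts G, forall z, connected_graph (del_vertex G z)}].

(** Starts from any path from [a] to [b] and moves its end, edge by edge, along a path from [b] to
    [y] in [G] without [a]. *)
Lemma path_through G a b y : biconnected G ->
  a \in verts G -> b \in verts G -> y \in verts G -> a != b -> a != y ->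
  exists p q,
  [/\ path (adj G) a (p ++ b :: q), last b q = y & uniq (a :: p ++ b :: q)].
Proof.
move=> [symG vG cG dG] aG bG yG ab ay.
have /connectP[r pr ->] : connect (adj (del_vertex G a)) b y.
  by apply: dG; rewrite // !inE eq_sym ?ab ?ay.
elim/last_ind: r pr => [_ | r z IHr].
  have /connectP[r pr br] := cG _ _ aG bG.
  case/shortenP: pr br => r' pr' ur' _ br.
  case/lastP: r' pr' ur' br => [|r' c] pr' ur' br.
    by move: ab; rewrite br eqxx.
  rewrite last_rcons in br; exists r', [::].
  by rewrite br cats1.
rewrite rcons_path last_rcons => /andP[/IHr thr] /= /and3P[yz ya za].
have [zG lG] : z \in verts G /\ last b r \in verts G.
  by split; [apply: vG yz | rewrite symG in yz; apply: vG yz].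
apply: (through_step symG _ yz za thr).
by move=> zb; apply: dG; rewrite // !inE ?(eq_sym a) ?(eq_sym b) ?za ?zb ?aG ?bG.
Qed.

Lemma path_verts G x p :
  biconnected G -> path (adj G) x p -> {in p, forall y, y \in verts G}.
Proof.
move=> [_ vG _ _]; elim: p x => // y p IHp x /= /andP[/vG yG /IHp pG] z.
by rewrite inE => /predU1P[->|/pG].
Qed.

Lemma walk_graph_sym s : symmetric (adj (walk_graph s)).
Proof. by move=> x y; rewrite /= orbC. Qed.

Lemma walk_graph_verts s x y : adj (walk_graph s) x y -> y \in s.
Proof.
by move=> /= /orP[] /mem_infix-> //; rewrite !inE eqxx ?orbT.
Qed.

Lemma walk_graph_path x s : path (adj (walk_graph (x :: s))) x s.
Proof.
suff walk s0 : infix (x :: s) s0 -> path (adj (walk_graph s0)) x s.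
  exact/walk/infix_refl.
elim: s x => // y s IHs x /infixP[s1 [s2 es]]; apply/andP; split.
  by apply/orP; left; apply/infixP; exists s1, (s ++ s2).
by apply/IHs/infixP; exists (rcons s1 x), s2; rewrite cat_rcons.
Qed.

Lemma attach_ear_sym G a p b :
  symmetric (adj G) -> symmetric (adj (attach_ear G a p b)).
Proof. by move=> symG x y; congr (_ || _); [apply: symG | apply: walk_graph_sym]. Qed.

(** In [G] without [v] some path leads from [u] to a third vertex; its first step gives the
    neighbour. *)
Lemma third_neighbour G u v : biconnected G -> 2 < #|verts G| ->
  u \in verts G -> v \in verts G -> u != v ->
  exists w, [/\ adj G u w, u != w & w != v].
Proof.
move=> [_ _ _ dG] V3 uG vG uv.
have [w] : exists w, w \in verts G :\ v :\ u.
  apply/card_gt0P; move: V3.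
  by rewrite (cardsD1 v) vG (cardsD1 u) !inE uv uG.
rewrite !inE => /and3P[wu wv wG].
have /connectP[p] : connect (adj (del_vertex G v)) u w.
  by apply: dG; rewrite // !inE ?uv ?wv.
case/shortenP => -[|x q] /= pq uq _ wuE.
  by rewrite wuE eqxx in wu.
case/andP: pq uq => /and3P[ux _ xv] _ /andP[]; rewrite inE negb_or => /andP[ux' _] _.
by exists x.
Qed.

(** * Lengths of an ear and of the paths between its ends *)

Section EarLength.
Variables (k m k' : nat) (G : graph T) (u v : T) (E : seq T).
Hypotheses (m_odd : odd m) (k'_half : 2 * k' = k %[mod m]).
Hypotheses (bG : biconnected G) (G_large : 2 < #|verts G|).
Hypotheses (G_cycles : cycles_congruent G k m) (E_ear : is_new_ear G u E v).
Hypothesis H_cycles : cycles_congruent (attach_ear G u E v) k m.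

Lemma ear_ends_neq : u != v.
Proof.
have /andP[/and4P[_ _ uE _] _] := E_ear; move: uE.
by rewrite /= mem_rcons inE negb_or => /andP[/andP[]].
Qed.

Lemma ear_cycle p : is_path G u p v -> (size E).+1 + size p = k %[mod m].
Proof.
have [symG vG _ _] := bG.
have /andP[/and4P[uG vvG uE EG] Enew] := E_ear.
case/and4P=> _ pp up /eqP lp.
have pG := path_verts bG pp.
have -> : (size E).+1 + size p = size (u :: p ++ rev E).
  by rewrite /= size_cat size_rev addnC addnS.
apply: H_cycles; apply/and3P; split.
- rewrite /= size_cat size_rev.
  case: p pp up lp {pG} => [|x [|y p]] /= pp _ lp; last by [].
    by move: ear_ends_neq; rewrite lp eqxx.
  (* If the path is the single edge [uv], the ear, being new, has an internal vertex, so the cycle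
     still has at least three vertices. *)
  by case: (E) Enew => //=; rewrite -lp; case: (adj G u x) pp.
- have pE := walk_graph_path u (rcons E v).
  rewrite /= rcons_cat cat_path lp (@sub_path _ (adj G)) => [|x y /= ->|] //=.
  apply: path_rev_sym; first exact: attach_ear_sym.
  by apply: sub_path pE => x y /= ->; rewrite orbT.
- rewrite -cat_cons cat_uniq up rev_uniq.
  move: uE; rewrite /= rcons_uniq => /and3P[_ _ ->]; rewrite andbT.
  apply/hasPn => x; rewrite mem_rev => /(allP EG) xG.
  by apply: contra xG; rewrite inE => /predU1P[->|/pG].
Qed.

Lemma ear_and_path_length :
  (size E).+1 = k' %[mod m] /\
  forall p, is_path G u p v -> size p = k' %[mod m].
Proof.
have [symG vG _ _] := bG.
have /andP[/and4P[uG vvG _ _] _] := E_ear.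
have [w [uw uw' wv]] := third_neighbour bG G_large uG vvG ear_ends_neq.
(* The edge [wu] closes this path to a cycle of [G] through [u] and [v], whose two arcs are the two
   paths to compare with the ear. *)
have [p [q [pq lq upq]]] := path_through bG uG vvG (vG _ _ uw) ear_ends_neq uw'.
have c_len : size (u :: p ++ v :: q) = k %[mod m].
  apply: G_cycles; apply/and3P; split=> //.
  - by case: q lq {pq upq} => [vw|x q _]; [rewrite -vw eqxx in wv|rewrite /= size_cat /= !addnS].
  - by rewrite /= rcons_path pq last_cat /= lq symG.
have p_len : (size E).+1 + size (rcons p v) = k %[mod m].
  apply: ear_cycle; apply/and4P; split=> //.
  - by move: pq; rewrite -cat_rcons cat_path => /andP[].
  - by move: upq; rewrite -cat_rcons -cat_cons cat_uniq => /and3P[].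
  - by rewrite last_rcons.
have q_len : (size E).+1 + size (rcons (rev q) v) = k %[mod m].
  apply: ear_cycle; apply/and4P; split=> //.
  - apply: path_rev_sym => //.
    rewrite rcons_path lq symG uw.
    by move: pq; rewrite -cat_rcons cat_path last_rcons => /andP[_ ->].
  - rewrite -rev_cons cons_uniq mem_rev rev_uniq; move: upq.
    by rewrite cons_uniq mem_cat negb_or cat_uniq => /and4P[/andP[_ ->] _ _ ->].
  - by rewrite last_rcons.
have e_len : (size E).+1 = k' %[mod m].
  (* The sum of the congruences for the two arcs, minus that for the cycle, is 2|E| = k, which is 2
     k'. *)
  apply: modn_double_inj m_odd _; move: c_len p_len q_len k'_half.
  rewrite /= size_cat !size_rcons size_rev /= => /eqmodP[c3 [d3 E3]].
  move=> /eqmodP[c1 [d1 E1]] /eqmodP[c2 [d2 E2]] /eqmodP[c4 [d4 E4]].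
  apply/eqmodP; exists (c1 + c2 + d3 + d4), (d1 + d2 + c3 + c4).
  by clear -E1 E2 E3 E4; lia.
split=> // r /ear_cycle; move: e_len k'_half.
move=> /eqmodP[c1 [d1 E1]] /eqmodP[c2 [d2 E2]] /eqmodP[c3 [d3 E3]].
apply/eqmodP; exists (d1 + c3 + d2), (c1 + d3 + c2).
by clear -E1 E2 E3; lia.
Qed.

End EarLength.

(** * Paths between the ends of an attached ear *)

Lemma uniq_pivot s1 s2 s3 s4 x :
  uniq (s1 ++ x :: s2) -> s1 ++ x :: s2 = s3 ++ x :: s4 -> s1 = s3 /\ s2 = s4.
Proof.
rewrite cat_uniq /= => /and4P[_ /norP[xs1 _] xs2 _] /eqP.
by rewrite eqseq_pivotl // => /andP[/eqP-> /eqP->].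
Qed.

Lemma uniq_pivot_notin s1 s2 x z :
  uniq (s1 ++ x :: s2) -> (z \notin s1) || (z \notin s2).
Proof.
rewrite cat_uniq => /and3P[_ /hasPn s1N _].
rewrite -negb_and; apply/andP => -[z1 z2].
by have := s1N z; rewrite inE z2 orbT z1 => /(_ isT).
Qed.

(** A path that has entered the ear cannot leave it before [v]: an internal vertex has only its two
    neighbours on the ear, and the previous one is already used. *)
Lemma follow_ear G u E v s1 x w s2 q :
  biconnected G -> is_ear G u E v -> u :: rcons E v = s1 ++ x :: w :: s2 ->
  path (adj (attach_ear G u E v)) w q -> uniq (x :: w :: q) -> last w q = v ->
  q = s2.
Proof.
move=> bG /and4P[uG vG uE /allP EG]; have [symG adjG _ _] := bG.
elim: s2 s1 x w q => [|w' s2 IHs] s1 x w q eW.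
  have -> : v = w by have := last_rcons u E v; rewrite -(last_cons u) eW last_cat.
  by case: q => // y q _ /= /and3P[_ wq _] ly; rewrite -ly mem_last in wq.
have wW : uniq (rcons s1 x ++ w :: w' :: s2) by rewrite cat_rcons -eW.
have wv : w != v.
  have -> : v = last w' s2.
    by have := last_rcons u E v; rewrite -(last_cons u) eW last_cat.
  apply: contraTneq wW => ->; rewrite cat_uniq cons_uniq mem_last.
  by rewrite /= !andbF.
have wu : w != u.
  apply: contraTneq wW => ->.
  case: s1 eW => [[<- _]|_ s1 [<- _]] /=; first by rewrite inE eqxx.
  by rewrite mem_cat mem_head orbT.
have wNG : w \notin verts G.
  apply: EG; have : w \in u :: rcons E v by rewrite eW mem_cat !inE eqxx !orbT.
  by rewrite inE mem_rcons inE (negPf wu) (negPf wv).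
case: q => [_ _ /= wvE|y q]; first by rewrite wvE eqxx in wv.
move=> /andP[wy pq]; rewrite cons_uniq => /andP[xNq yq] lq.
have yx : y != x by apply: contraNneq xNq => ->; rewrite !inE eqxx orbT.
have y_next : y = w'.
  case/or3P: wy => [|/infixP[t1 [t2 eW2]]|/infixP[t1 [t2 eW2]]].
  - by rewrite symG => /adjG wG; rewrite wG in wNG.
  - have [_ [->]] : rcons s1 x = t1 /\ w' :: s2 = y :: t2; last by [].
    by apply: uniq_pivot wW _; rewrite cat_rcons -eW eW2.
  - have [/rcons_inj[_ xy] _] : rcons s1 x = rcons t1 y /\ w' :: s2 = t2.
      by apply: uniq_pivot wW _; rewrite !cat_rcons -eW eW2.
    by rewrite xy eqxx in yx.
rewrite y_next in pq yq lq *; congr (_ :: _).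
by apply: (IHs (rcons s1 x) w w') => //; rewrite cat_rcons.
Qed.

(** If the first edge is in [G], each later vertex before [v] is in [G] and is not an end of the
    ear, so the path stays in [G]. Otherwise the first edge is that of the ear and [follow_ear]
    applies. *)
Lemma path_attach_ear G u E v p :
  biconnected G -> is_ear G u E v -> is_path (attach_ear G u E v) u p v ->
  is_path G u p v \/ p = rcons E v.
Proof.
move=> bG Eear /and4P[_ pp up /eqP lp]; have [symG adjG _ _] := bG.
have /and4P[uG vG uE /allP EG] := Eear.
case: p pp up lp => [|y p]; first by left; apply/and4P; split=> //; apply/eqP.
move=> pp up lp; have /andP[uy py] := pp.
have [uyG|uyNG] := boolP (adj G u y); last first.
  right; case/or3P: uy => [uyG|/infixP[t1 [t2 eW]]|/infixP[t1 [t2 eW]]].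
  - by rewrite uyG in uyNG.
  - have [t1E tE] : [::] = t1 /\ rcons E v = y :: t2.
      by apply: (uniq_pivot (x := u)); rewrite //= -eW.
    by rewrite tE (follow_ear (s1 := [::]) (s2 := t2) bG Eear _ py up lp) //= tE.
  - have [] : [::] = rcons t1 y /\ rcons E v = t2.
      by apply: (uniq_pivot (x := u)); rewrite //= cat_rcons -eW.
    by case: (t1).
left; apply/and4P; split=> //; last exact/eqP.
apply/andP; split=> //.
have yG := adjG _ _ uyG.
move: up; rewrite cons_uniq => /andP[].
elim: p y yG py lp {uy uyG pp} => // z p IHp y yG /andP[yz pz] lp.
rewrite inE negb_or cons_uniq => /andP[uy uN] /andP[yN uz].
have yv : y != v by apply: contraNneq yN => ->; rewrite -lp; apply: (mem_last z p).
have yW : y \notin u :: rcons E v.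
  rewrite inE mem_rcons inE (eq_sym y u) (negPf uy) (negPf yv) /=.
  by apply: contraL yG => /EG.
have yzG : adj G y z.
  case/or3P: yz yW => // /mem_infix iW /negP[]; apply: iW.
    exact: mem_head.
  by rewrite !inE eqxx orbT.
by apply/andP; split=> //; apply: (IHp z (adjG _ _ yzG)).
Qed.

(** * Cycles and ear attachments give 2-connected graphs *)

Lemma del_vertex_sym G z : symmetric (adj G) -> symmetric (adj (del_vertex G z)).
Proof. by move=> symG x y; rewrite /= symG andbC -andbA andbC -!andbA [RHS]andbCA. Qed.

Lemma path_del_vertex G x p z : path (adj G) x p -> z \notin x :: p ->
  path (adj (del_vertex G z)) x p.
Proof.
elim: p x => // y p IHp x /andP[xy py]; rewrite inE negb_or => /andP[xz zN].
apply/andP; split; last exact: IHp.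
move: zN; rewrite inE negb_or => /andP[yz _].
by rewrite /= xy -!(eq_sym z) xz.
Qed.

(** The side of [x] that avoids [z] still leads to an end. This serves ears, and also cycles, read
    as closed walks with [u] = [v]. *)
Lemma connect_to_ends G u v x z p1 p2 : symmetric (adj G) ->
  path (adj G) u (rcons (p1 ++ x :: p2) v) -> x != z ->
  (z \notin u :: p1) || (z \notin rcons p2 v) ->
  exists2 y, y \in [:: u; v] & (y != z) && connect (adj (del_vertex G z)) x y.
Proof.
move=> symG; rewrite rcons_cat -cat_rcons cat_path last_rcons => /andP[pux pxv].
move=> xz /orP[zN|zN]; [exists u|exists v]; rewrite ?inE ?eqxx ?orbT //.
  move/(path_rev_sym symG)/(@path_del_vertex _ _ _ z): pux => pux.
  apply/andP; split.
    by apply: contraNneq zN => ->; rewrite mem_head.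
  apply: (path_connect (pux _)); last by rewrite inE mem_rcons mem_head orbT.
  by rewrite inE mem_rcons inE mem_rev eq_sym (negPf xz).
apply/andP; split; first by apply: contraNneq zN => ->; rewrite mem_rcons mem_head.
apply: (path_connect (path_del_vertex (z := z) pxv _)).
  by rewrite inE eq_sym (negPf xz).
by rewrite inE mem_rcons mem_head orbT.
Qed.

Lemma connected_via (f : rel T) (A S : {pred T}) : symmetric f ->
  {in A, forall x, exists2 y, y \in S & connect f x y} ->
  {in S &, forall x y, connect f x y} -> {in A &, forall x y, connect f x y}.
Proof.
move=> symf AS conS x y /AS[x' x'S xx'] /AS[y' y'S yy'].
apply: connect_trans xx' (connect_trans (conS _ _ x'S y'S) _).
by rewrite sym_connect_sym.
Qed.

Lemma connected_from (f : rel T) (A : {pred T}) x : symmetric f ->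
  {in A, forall y, connect f y x} -> {in A &, forall y z, connect f y z}.
Proof.
move=> symf Ax y z /Ax yx /Ax zx.
by apply: connect_trans yx _; rewrite sym_connect_sym.
Qed.

Lemma attach_ear_biconnected G a p b :
  biconnected G -> is_ear G a p b -> biconnected (attach_ear G a p b).
Proof.
move=> [symG adjG conG delG] /and4P[aG bG up /allP pNG].
set H := attach_ear G a p b; have symH : symmetric (adj H) by apply: attach_ear_sym.
have pathH : path (adj H) a (rcons p b).
  by apply: sub_path (walk_graph_path _ _) => x y /= ->; rewrite orbT.
have GH : subrel (adj G) (adj H) by move=> x y /= ->.
split=> // [x y /orP[/adjG yG|/walk_graph_verts yW] | | z _].
- by rewrite inE yG.
- by rewrite inE orbC inE yW.
- apply: (@connected_via _ _ (mem (verts G))) => // [x|x y xG yG]; last first.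
    by apply: (connect_sub (fun x y xy => connect1 (GH x y xy))); apply: conG.
  rewrite in_setU => /orP[xG|]; first by exists x.
  rewrite inE => xW; exists a => //.
  by rewrite sym_connect_sym //; apply: (path_connect pathH).
- apply: (@connected_via _ _ (mem (verts G :\ z))) => [|x|x y xG yG].
  + exact: del_vertex_sym.
  + rewrite in_setD1 in_setU => /andP[xz] /orP[xG|].
      by exists x; rewrite // !inE xz.
    rewrite inE => xW; have [xG|xNG] := boolP (x \in verts G).
      by exists x; rewrite // !inE xz.
    have xp : x \in p.
      move: xW; rewrite inE mem_rcons inE => /or3P[/eqP xE|/eqP xE|//].
        by rewrite xE aG in xNG.
      by rewrite xE bG in xNG.
    case/splitPr: xp pathH up => p1 p2 pathH up.
    have [|y yab /andP[yz xy]] := connect_to_ends (z := z) symH pathH xz.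
      by apply: (@uniq_pivot_notin _ _ x); move: up; rewrite rcons_cat.
    exists y => //; rewrite !inE yz.
    by move: yab; rewrite !inE => /orP[]/eqP->.
  + apply: (@connect_sub _ (adj (del_vertex G z))) => [x' y' /and3P[xy' xz' yz']|].
      by apply: connect1; rewrite /= xy' xz'.
    move: (xG) (yG); rewrite !in_setD1 => /andP[_ xG'] _.
    (* If [z] is not in [G], it is internal to the ear and its deletion leaves [G] intact. *)
    have [zG|zNG] := boolP (z \in verts G); first exact: delG.
    have yG' : y \in verts G by move: yG; rewrite inE => /andP[].
    apply: (@connect_sub _ (adj G)) (conG _ _ xG' yG') => x' y' xy'.
    apply: connect1; rewrite /= xy' /=.
    apply/andP; split; first by apply: contraNneq zNG => <-; rewrite symG in xy'; apply: adjG xy'.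
    by apply: contraNneq zNG => <-; apply: adjG xy'.
Qed.

(** Without [x] the path [c] remains; without another vertex, every vertex still reaches [x] along
    one of its two arcs. *)
Lemma cycle_biconnected x c :
  1 < size c -> uniq (x :: c) -> biconnected (walk_graph (x :: rcons c x)).
Proof.
move=> c1 uc; set H := walk_graph _.
have symH : symmetric (adj H) by apply: walk_graph_sym.
have pathH : path (adj (walk_graph (x :: rcons c x))) x (rcons c x) by apply: walk_graph_path.
split=> // [x' y' /walk_graph_verts yW | | z _].
- by rewrite inE.
- apply: (@connected_from _ _ x) => // w; rewrite inE => wW.
  by rewrite sym_connect_sym //; apply: (path_connect pathH).
- have [->|zx] := eqVneq z x.
    have symD := del_vertex_sym x symH.
    case: c c1 uc pathH @H symH symD => // h c _ uc pathH H symH symD.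
    apply: (@connected_from _ _ h) => // w.
    rewrite in_setD1 inE inE mem_rcons inE orbA orbb.
    move=> /andP[wx /predU1P[wE|wc]]; first by rewrite wE eqxx in wx.
    rewrite sym_connect_sym //.
    apply: (path_connect (path_del_vertex _ _) wc).
      by move: pathH; rewrite rcons_path => /andP[/andP[]].
    by case/andP: uc.
  have symD := del_vertex_sym z symH.
  apply: (@connected_from _ _ x) => // w.
  rewrite in_setD1 inE inE mem_rcons inE orbA orbb => /andP[wz /predU1P[->//|wc]].
  case/splitPr: wc pathH uc {c1} @H symH symD => p1 p2 pathH uc H symH symD.
  have [|y yx /andP[_ wy]] := connect_to_ends (z := z) symH pathH wz.
    rewrite inE mem_rcons inE (negPf zx).
    by apply: (@uniq_pivot_notin _ _ w); case/andP: uc.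
  by move: yx wy; rewrite !inE orbb => /eqP->.
Qed.

Lemma ear_chain_biconnected G Ps :
  ear_chain G Ps -> biconnected G /\ 2 < #|verts G|.
Proof.
elim=> [x c c1 uc|{}G {}Ps u p v _ [bG V3] ear].
  split; first exact: cycle_biconnected.
  rewrite /= (@eq_card _ _ (mem (x :: c))); first by rewrite (card_uniqP uc).
  by move=> y; rewrite !inE mem_rcons inE orbA orbb.
split; first exact: attach_ear_biconnected.
by apply: leq_trans V3 (subset_leq_card _); apply: subsetUl.
Qed.

(** * Paths from inside the last ear to the rest of the graph *)

(** Gives s + k' = r with s = [(size pa).+1] and r = [(size pb).+1]. The two pieces of the ear are
    separate arguments, so that the roles of [a] and [b] can be exchanged. *)
Lemma detour_length (k' m : nat) G H a b x y pa pb :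
  biconnected G -> subrel (adj G) (adj H) ->
  [/\ a \in verts G, b \in verts G & y \in verts G] ->
  [/\ a != b, a != y & b != y] ->
  (forall p, is_path G a p b -> size p = k' %[mod m]) ->
  (forall p, is_path H x p y -> size p = k' %[mod m]) ->
  is_path H x (rcons pa a) a -> is_path H x (rcons pb b) b ->
  [predU1 x & pa] \subset [predC (verts G)] ->
  [predU1 x & pb] \subset [predC (verts G)] ->
  (size pa).+1 + k' = (size pb).+1 %[mod m].
Proof.
move=> bG GH [aG bbG yG] [ab ay bY] Pab Pxy.
case/and4P=> xH pxa uxa _ /and4P[_ pxb uxb _] xaG xbG.
have [p [q [pq lq upq]]] := path_through bG aG bbG yG ab ay.
have pqG : {in rcons p b ++ q, forall z, z \in verts G}.
  by apply: (path_verts bG (x := a)); rewrite cat_rcons.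
have disj s z r : [predU1 x & s] \subset [predC (verts G)] -> uniq (x :: rcons s z) ->
    uniq (z :: r) -> {in r, forall w, w \in verts G} -> uniq (x :: rcons s z ++ r).
  move=> /subsetP sG us; rewrite cons_uniq => /andP[zr ur] rG.
  rewrite -cat_cons cat_uniq us ur andbT; apply/hasPn => w wr.
  have wG := rG w wr; rewrite -rcons_cons mem_rcons inE.
  apply/norP; split; first by apply: contraNneq zr => <-.
  by apply: contraL wG => ws; have := sG w; rewrite inE => /(_ ws).
have xaby : size (rcons pa a ++ p ++ b :: q) = k' %[mod m].
  apply: Pxy; apply/and4P; split=> //.
  - by rewrite cat_path pxa last_rcons (sub_path GH).
  - by apply: disj => // z; rewrite -cat_rcons => /pqG.
  - by rewrite !last_cat /= lq.
have xby : size (rcons pb b ++ q) = k' %[mod m].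
  apply: Pxy; apply/and4P; split=> //.
  - rewrite cat_path pxb last_rcons (sub_path GH) //.
    by move: pq; rewrite cat_path /= => /and3P[].
  - apply: disj => // [|z zq]; last by apply: pqG; rewrite mem_cat zq orbT.
    by move: upq; rewrite cons_uniq cat_uniq => /and4P[].
  - by rewrite last_cat last_rcons lq.
have aby : size (rcons p b) = k' %[mod m].
  apply: Pab; apply/and4P; split=> //.
  - by move: pq; rewrite -cat_rcons cat_path => /andP[].
  - by move: upq; rewrite -cat_rcons -cat_cons cat_uniq => /and3P[].
  - by rewrite last_rcons.
move: xaby xby aby; rewrite !size_cat !size_rcons /=.
move=> /eqmodP[c1 [d1 E1]] /eqmodP[c2 [d2 E2]] /eqmodP[c3 [d3 E3]].
apply/eqmodP; exists (c1 + d2 + d3), (d1 + c2 + c3).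
by clear -E1 E2 E3; lia.
Qed.

Lemma is_path_rev G u p v : biconnected G -> u != v -> is_path G u p v ->
  exists2 q, size q = size p & is_path G v q u.
Proof.
move=> bG uv /and4P[uG pp up /eqP lp].
case/lastP: p pp up lp => [_ _ uvE|p v']; first by rewrite -uvE eqxx in uv.
rewrite last_rcons => pp up v'v; rewrite {v'}v'v in pp up *.
exists (rcons (rev p) u); first by rewrite !size_rcons size_rev.
apply/and4P; split; last by rewrite last_rcons.
- by apply: (path_verts bG pp); rewrite mem_rcons mem_head.
- by apply: path_rev_sym pp; case: bG.
- by rewrite -rev_cons -rev_rcons rev_uniq rcons_cons.
Qed.

Lemma inner_outer_path_length k m k' G a p b x y :
  0 < k < m -> odd m -> 2 * k' = k %[mod m] ->
  biconnected G -> 2 < #|verts G| -> is_ear G a p b ->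
  cycles_congruent (attach_ear G a p b) k m ->
  x \in p -> y \in verts G -> a != y -> b != y ->
  ~ (forall q, is_path (attach_ear G a p b) x q y -> size q = k' %[mod m]).
Proof.
move=> /andP[k0 km] m_odd k'k bG V3 ear cycH xp yG ay bY.
set H := attach_ear G a p b => Pxy.
have /and4P[aG bbG up /allP pNG] := ear.
have GH : subrel (adj G) (adj H) by move=> w z /= ->.
(* The ear has the internal vertex [x], so it is new and [ear_and_path_length] gives length k' to
   the paths of [G] between [a] and [b]. *)
have new : is_new_ear G a p b by rewrite /is_new_ear ear; case: (p) xp.
have cycG : cycles_congruent G k m.
  move=> c /and3P[c3 cyc uc]; apply: cycH; apply/and3P; split=> //.
  by apply: sub_cycle cyc.
have [_ Pab] := ear_and_path_length m_odd k'k bG V3 cycG new cycH.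
have ab := ear_ends_neq new.
have Pba q : is_path G b q a -> size q = k' %[mod m].
  rewrite eq_sym in ab.
  by case/(is_path_rev bG ab) => q' <-; apply: Pab.
have [symH _ _ _] := attach_ear_biconnected bG ear.
have pathH : path (adj H) a (rcons p b).
  by apply: sub_path (walk_graph_path _ _) => w z /= ->; rewrite orbT.
have xH : x \in verts H by rewrite !inE mem_rcons inE xp !orbT.
case/splitPr ep : {1}p / xp => [p1 p2].
have outer s : {subset s <= p} -> [predU1 x & s] \subset [predC verts G].
  move=> sp; apply/subsetP => z; rewrite !inE => zs; apply: pNG.
  by case/predU1P: zs => [->|/sp//]; rewrite ep mem_cat mem_head orbT.
have out1 : [predU1 x & rev p1] \subset [predC verts G].
  by apply: outer => z; rewrite mem_rev ep mem_cat => ->.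
have out2 : [predU1 x & p2] \subset [predC verts G].
  by apply: outer => z; rewrite ep mem_cat inE orbC => ->; rewrite orbT.
have /andP[pax pxb] : path (adj H) a (rcons p1 x) && path (adj H) x (rcons p2 b).
  by move: pathH; rewrite ep rcons_cat -cat_rcons cat_path last_rcons.
have [uax uxb] : uniq (a :: rcons p1 x) /\ uniq (x :: rcons p2 b).
  have := up; rewrite ep rcons_cat => u1; split.
    by move: u1; rewrite -cat_rcons -(cat_cons a) cat_uniq => /andP[].
  by move: u1; rewrite -(cat_cons a) cat_uniq => /and3P[].
have Hxa : is_path H x (rcons (rev p1) a) a.
  apply/and4P; split; rewrite ?last_rcons //; first exact: path_rev_sym.
  by rewrite -rev_cons -rev_rcons rev_uniq rcons_cons.
have Hxb : is_path H x (rcons p2 b) b.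
  by apply/and4P; split; rewrite ?last_rcons.
have ba : b != a by rewrite eq_sym.
have := detour_length bG GH (And3 aG bbG yG) (And3 ab ay bY) Pab Pxy Hxa Hxb out1 out2.
have := detour_length bG GH (And3 bbG aG yG) (And3 ba bY ay) Pba Pxy Hxb Hxa out2 out1.
rewrite size_rev => /eqmodP[c1 [d1 E1]] /eqmodP[c2 [d2 E2]].
have : 2 * k' = 0 %[mod m].
  by apply/eqmodP; exists (c1 + c2), (d1 + d2); clear -E1 E2; lia.
by rewrite k'k mod0n modn_small // => k_eq0; rewrite k_eq0 in k0.
Qed.

(** The extra ear of the theorem enters only through the lengths of the [x]-[y] paths. This
    hypothesis passes down to the union of fewer ears, whose paths are paths of the larger graph, so
    induction on the chain applies. *)
Lemma ear_chain_same_ear k m k' G Ps :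
  0 < k < m -> odd m -> 2 * k' = k %[mod m] ->
  ear_chain G Ps -> cycles_congruent G k m ->
  {in verts G &, forall x y, x != y ->
    (forall p, is_path G x p y -> size p = k' %[mod m]) ->
    exists2 P, P \in Ps & (x \in P) && (y \in P)}.
Proof.
move=> km m_odd k'k; elim=> [x c c1 uc _ y z|{}G {}Ps a p b chain IHG ear cycH x y].
  rewrite !inE !mem_rcons !inE !orbA !orbb => yc zc _ _.
  by exists (x :: c); rewrite ?mem_head // !inE yc.
have [bG V3] := ear_chain_biconnected chain.
have bH := attach_ear_biconnected bG ear.
have /and4P[aG bbG _ _] := ear.
move=> xH yH xy Pxy.
set W := a :: rcons p b in xH yH *.
have [/andP[xW yW]|] := boolP ((x \in W) && (y \in W)).
  by exists W; rewrite ?mem_rcons ?mem_head ?xW.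
have [/andP[xG yG] _|] := boolP ((x \in verts G) && (y \in verts G)).
  have [|q qG|P PPs xyP] := IHG _ _ _ xG yG xy.
  - move=> c /and3P[c3 cyc uc]; apply: cycH; apply/and3P; split=> //.
    by apply: sub_cycle cyc => w z /= ->.
  - apply: Pxy; case/and4P: qG => _ pq uq lq; apply/and4P; split=> //.
    by apply: sub_path pq => w z /= ->.
  - by exists P; rewrite // mem_rcons inE PPs orbT.
have inner z : z \in W -> z \notin verts G -> z \in p.
  rewrite inE mem_rcons inE => /or3P[/eqP->|/eqP->|//]; first by rewrite aG.
  by rewrite bbG.
have outer z : z \notin W -> (a != z) && (b != z).
  by rewrite !inE mem_rcons inE !negb_or ![z == _]eq_sym => /and3P[-> -> _].
have cases z : z \in verts (attach_ear G a p b) -> (z \in verts G) || (z \in W).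
  by rewrite inE [z \in finset _]inE.
have {xH yH} := (cases _ xH, cases _ yH).
(* What remains is one vertex internal to the last ear and the other off that ear, against
   [inner_outer_path_length]. *)
have [xG|xG] := boolP (x \in verts G); have [yG|yG] := boolP (y \in verts G);
  rewrite ?orbT //=.
- move=> [_ yW] _; rewrite yW andbT => /outer/andP[ax bx].
  have := @inner_outer_path_length _ _ _ _ _ _ _ y x km m_odd k'k bG V3 ear cycH (inner _ yW yG) xG ax bx.
  case=> q; rewrite eq_sym in xy; case/(is_path_rev bH xy) => q' <-; exact: Pxy.
- move=> [xW _] _; rewrite xW => /outer/andP[ay bY].
  by have := @inner_outer_path_length _ _ _ _ _ _ _ x y km m_odd k'k bG V3 ear cycH (inner _ xW xG) yG ay bY.
- by case=> -> ->.
Qed.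
End Graphs.

Theorem theorem2p2 (k m k' : nat) (T : finType) (G : graph T)
    (u v : T) (E : seq T)
    (k_gt0 : 0 < k) (k_lt_m : k < m) (m_odd : odd m)
    (k'_half : 2 * k' = k %[mod m])
    (G_simple : simple_graph G) (G_2conn : two_connected G)
    (G_cycles : cycles_congruent G k m)
    (E_ear : is_new_ear G u E v)
    (H_cycles : cycles_congruent (attach_ear G u E v) k m) :
  (forall p : seq T, is_path (attach_ear G u E v) u p v ->
     size p = k' %[mod m]) /\
  (forall Ps : seq (seq T), ear_decomposition G Ps ->
     exists i : nat, [/\ i < size Ps, u \in nth [::] Ps i & v \in nth [::] Ps i]).
Proof.
have [symG _ vG] := G_simple; have [V3 conG delG] := G_2conn.
have bG : biconnected G by split=> // x y /vG/andP[].
have [E_len Puv] := ear_and_path_length m_odd k'_half bG V3 G_cycles E_ear H_cycles.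
have uv := ear_ends_neq E_ear.
have /andP[ear _] := E_ear; have /and4P[uG vvG _ _] := ear.
split=> [p /(path_attach_ear bG ear) [/Puv//|->]|Ps [G' chain [eqV eqE]]].
  by rewrite size_rcons.
(* The chain builds [G'], which has the vertices and the adjacency of [G], so cycles and paths carry
   over. *)
have [||||||P] := ear_chain_same_ear (k' := k') _ m_odd k'_half chain _ (x := u) (y := v).
- by rewrite k_gt0.
- move=> c /and3P[c3 cyc uc]; apply: G_cycles; apply/and3P; split=> //.
  by rewrite -(eq_cycle eqE).
- by rewrite eqV.
- by rewrite eqV.
- by [].
- move=> p; rewrite /is_path eqV (eq_path eqE); exact: Puv.
by move=> /(nthP [::])[i ilt <-] /andP[ui vi]; exists i.
Qed.
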